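(* For every $p\in\mathbb{N}$, each of the following problems, on inputs with parameter $n$ and independence number (resp. stability number) at most $\alpha$, can be solved by a $p$-pass deterministic streaming algorithm using $O(\alpha n^{1+1/p})$ space in the insertion-only model and $O(\alpha n^{1+O(1/\sqrt{p})})$ space in the turnstile model: (i) computing a topological ordering of an $n$-node directed acyclic graph; (ii) computing the strongly connected component decomposition of an $n$-node digraph; (iii) computing a minimum chain cover of an $n$-node directed acyclic graph; (iv) computing a satisfying assignment (or reporting none exists) of an $n$-variable 2-SAT formula.
   Context: All digraphs are simple; the independence number of a digraph is that of its underlying undirected graph. A chain of a digraph $G$ is a sequence of nodes forming a directed path in the transitive closure of $G$ (the digraph with an arc $(u,v)$ iff $G$ has a directed $u$–$v$ path); a chain cover is a collection of chains partitioning the node set, and a minimum chain cover has the fewest chains. The implication graph $G_F$ of a 2-SAT formula $F$ on $n$ variables has nodes $x$ and $\neg x$ for each variable $x$, and for each clause $(\ell\vee\ell')$ the arcs $(\neg\ell,\ell')$ and $(\neg\ell',\ell)$; the stability number of $F$ is the independence number of $G_F$. For 2-SAT the stream consists of the clauses (equivalently the arcs of $G_F$). Graph streaming model: arcs arrive in adversarial order, $p$ forward passes; insertion-only model has only insertions, turnstile allows deletions of previously inserted items. Space upper bounds are in words of $O(\log n)$ bits. *)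

(* Defs.v *)
From HB Require Import structures.
From mathcomp Require Import all_boot all_order all_algebra.
From mathcomp Require Import all_classical all_reals exp.

Set Implicit Arguments.
Unset Strict Implicit.
Unset Printing Implicit Defensive.

(** ** Digraphs *)

Definition digraph (V : finType) := {set V * V}.

Section Digraph.
Variables (V : finType) (G : digraph V).

Definition arc : rel V := [rel u v | (u, v) \in G].

Definition underlying : rel V := [rel u v | arc u v || arc v u].

Definition independent (S : {set V}) : bool :=
  [forall u in S, forall v in S, (u != v) ==> ~~ underlying u v].

Definition independence_number : nat :=
  \max_(S : {set V} | independent S) #|S|.

Definition acyclic : Prop := forall c : seq V, ucycle arc c -> c = [::].

(* [connect arc] is reflexive; the transitive closure is a simple digraph, so
   loops are left out. *)
Definition transitive_closure : digraph V :=
  [set e | (e.1 != e.2) && connect arc e.1 e.2].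

Definition topological_order (t : seq V) : Prop :=
  perm_eq t (enum V) /\ forall u v, arc u v -> index u t < index v t.

Definition strong_component (u : V) : {set V} :=
  [set v | connect arc u v && connect arc v u].

Definition strong_components : {set {set V}} :=
  [set strong_component u | u : V].

End Digraph.

Definition chain (V : finType) (G : digraph V) (c : seq V) : bool :=
  uniq c && sorted (arc (transitive_closure G)) c.

Definition chain_cover (V : finType) (G : digraph V) (cs : seq (seq V)) : bool :=
  [&& all (chain G) cs, [::] \notin cs & perm_eq (flatten cs) (enum V)].

Definition minimum_chain_cover (V : finType) (G : digraph V)
    (cs : seq (seq V)) : Prop :=
  chain_cover G cs /\ forall ds, chain_cover G ds -> size cs <= size ds.

(** ** 2-SAT *)

(* [(x, true)] is the literal x and [(x, false)] its negation. *)
Definition literal (n : nat) : finType := ('I_n * bool)%type.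

Definition neg (n : nat) (l : literal n) : literal n := (l.1, ~~ l.2).

(* A clause (l \/ l') is the set {l, l'}; l = l' is allowed. *)
Definition is_clause (n : nat) (c : {set literal n}) : bool :=
  [exists l, exists l', c == [set l; l']].

(* As digraphs are simple, the loops that a clause (l \/ ~ l) would create
   are left out, and parallel arcs are merged. *)
Definition implication_graph (n : nat) (F : {set {set literal n}}) :
    digraph (literal n) :=
  [set e | (e.1 != e.2) && ([set neg e.1; e.2] \in F)].

Definition stability_number (n : nat) (F : {set {set literal n}}) : nat :=
  independence_number (implication_graph F).

Definition satisfies (n : nat) (a : {ffun 'I_n -> bool})
    (F : {set {set literal n}}) : bool :=
  [forall c in F, exists l in c, a l.1 == l.2].

(** ** Streams *)

Inductive stream_model := InsertionOnly | Turnstile.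

(* [(true, x)] inserts x and [(false, x)] deletes x. *)
Definition update (T : Type) : Type := (bool * T)%type.

(* s is a stream of admissible items whose final content is X: no deletion
   ever removes an item that is not present, and in the end each element of X
   is present exactly once and nothing else is present. *)
Definition is_stream (M : stream_model) (T : finType) (admissible : pred T)
    (X : {set T}) (s : seq (update T)) : Prop :=
  [/\ forall u, u \in s -> admissible u.2,
      M = InsertionOnly -> forall u, u \in s -> u.1 = true,
      forall k x, count_mem (false, x) (take k s)
                  <= count_mem (true, x) (take k s)
    & forall x, count_mem (true, x) s = count_mem (false, x) s + (x \in X)].

(** ** Multi-pass deterministic streaming algorithms *)

(* A word has floor(log2 n) + 1 bits, so it holds any number 0, ..., n. *)
Definition word (n : nat) : Type := ((trunc_log 2 n).+1).-tuple bool.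

Definition memory (n S : nat) : Type := S.-tuple (word n).

(* Only the memory content is carried over from one stream item to the next
   and from one pass to the next. The [nat] argument of [process] and of
   [end_pass] is the index of the current pass. *)
Record algorithm (Mem Item Ans : Type) := Algorithm {
  start : Mem;
  process : nat -> Mem -> update Item -> Mem;
  end_pass : nat -> Mem -> Mem;
  output : Mem -> Ans
}.

Definition run_pass (Mem Item Ans : Type) (A : algorithm Mem Item Ans)
    (s : seq (update Item)) (m : Mem) (i : nat) : Mem :=
  end_pass A i (foldl (process A i) m s).

Definition run (Mem Item Ans : Type) (A : algorithm Mem Item Ans) (p : nat)
    (s : seq (update Item)) : Ans :=
  output A (foldl (run_pass A s) (start A) (iota 0 p)).

(** ** Problems *)

(* An input with parameter n is a finite set of items. [promise] is the class
   of inputs considered and [parameter] its independence or stability number. *)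
Record problem := Problem {
  item : nat -> finType;
  answer : nat -> Type;
  admissible : forall n, pred (item n);
  promise : forall n, {set item n} -> Prop;
  parameter : forall n, {set item n} -> nat;
  correct : forall n, {set item n} -> answer n -> Prop
}.

Definition digraph_problem (ans : nat -> Type)
    (prom : forall n, digraph 'I_n -> Prop)
    (corr : forall n, digraph 'I_n -> ans n -> Prop) : problem :=
  @Problem (fun n => ('I_n * 'I_n)%type) ans
    (fun n e => e.1 != e.2) prom
    (fun n G => independence_number G) corr.

Definition topological_ordering_problem : problem :=
  @digraph_problem (fun n => seq 'I_n)
    (fun n G => acyclic G) (fun n G t => topological_order G t).

Definition scc_problem : problem :=
  @digraph_problem (fun n => {set {set 'I_n}})
    (fun n G => True) (fun n G P => P = strong_components G).

Definition minimum_chain_cover_problem : problem :=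
  @digraph_problem (fun n => seq (seq 'I_n))
    (fun n G => acyclic G) (fun n G cs => minimum_chain_cover G cs).

Definition two_sat_problem : problem :=
  @Problem (fun n => {set literal n}) (fun n => option {ffun 'I_n -> bool})
    (fun n c => is_clause c) (fun n F => True)
    (fun n F => stability_number F)
    (fun n F r => match r with
                  | Some a => satisfies a F
                  | None => forall a, ~~ satisfies a F
                  end).

(* That X has admissible items only follows from [is_stream]. *)
Definition solvable_in_space (R : realType) (M : stream_model) (P : problem)
    (p n alpha : nat) (space : R) : Prop :=
  exists S : nat, (S%:R <= space)%R /\
  exists A : algorithm (memory n S) (item P n) (answer P n),
  forall (X : {set item P n}) (s : seq (update (item P n))),
    promise X -> parameter X <= alpha ->
    is_stream M (@admissible P n) X s ->
    correct X (run A p s).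

(* Main.v *)
From mathcomp Require Import all_boot all_order all_algebra.
From mathcomp Require Import all_classical all_reals exp.
From mathcomp Require Import zify ring lra.
From mathcomp Require Import fintype finset.
Require Import Defs.

Set Implicit Arguments.
Unset Strict Implicit.
Unset Printing Implicit Defensive.

(* All four answers are functions of the transitive closure of a digraph whose
   arcs are carried by the stream items, so it suffices to stream that closure.

   The nodes are split into blocks of k^l nodes, l = 0, 1, ..., and the closure
   of the digraph induced on each block is computed level by level. Since a
   block has independence number at most alpha, its closure is a preorder
   without antichains of more than alpha elements, hence by Dilworth's theorem
   a union of alpha chains; it is stored by the least element that each node
   reaches on each chain. To merge k blocks it is enough to know, for each
   node, each of the k blocks and each chain of it, the first out-neighbour of
   the node on the chain: all further ones are reachable from it.

   With insertions only, these minima are found in one pass with one word each,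
   so k = n^(1/p) gives alpha n^(1 + 1/p) words. With deletions, a minimum is
   found in q passes by k-ary search, with k counters that need to be correct
   only modulo a number exceeding the final counts; q = sqrt p passes for each
   of q levels with k = n^(1/q) use alpha n k^2 words. *)

(** * Dilworth's theorem for finite preorders *)

Section Dilworth.
Variables (V : finType) (T : rel V).
Hypotheses (T_refl : reflexive T) (T_trans : transitive T).

Definition rank (v : V) : nat := #|[set x | T x v]|.

Lemma rank_lt (v : V) : rank v < #|V|.+1.
Proof. by rewrite ltnS max_card. Qed.

Lemma leq_rank_rel (u v : V) : T u v || T v u -> rank u <= rank v -> T u v.
Proof.
case/orP=> // Tvu le_uv; have: [set x | T x v] == [set x | T x u].
  rewrite eqEcard le_uv andbT; apply/subsetP => x; rewrite !inE => Txv.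
  exact: T_trans Txv Tvu.
by move/eqP/setP/(_ u); rewrite !inE T_refl.
Qed.

Definition antichain (S : {set V}) : bool :=
  [forall u in S, forall v in S, T u v ==> (u == v)].

Lemma antichainP (S : {set V}) :
  reflect {in S &, forall u v, T u v -> u = v} (antichain S).
Proof.
apply: (iffP forall_inP) => [antiS u v uS vS Tuv|antiS u uS].
  by have /forall_inP/(_ v vS)/implyP/(_ Tuv)/eqP := antiS u uS.
by apply/forall_inP => v vS; apply/implyP => Tuv; apply/eqP/antiS.
Qed.

Lemma antichainU1 (a : V) (S : {set V}) :
  antichain S -> {in S, forall v, ~~ T a v && ~~ T v a} ->
  antichain (a |: S).
Proof.
move=> /antichainP antiS aNS; apply/antichainP => u v.
case/setU1P=> [->|uS] /setU1P [->|vS] //; last exact: antiS.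
  by case/andP: (aNS v vS) => /negbTE ->.
by case/andP: (aNS u uS) => _ /negbTE ->.
Qed.

Definition width_leq (A : {set V}) (m : nat) : Prop :=
  forall S : {set V}, S \subset A -> antichain S -> #|S| <= m.

Lemma width_leqS (A B : {set V}) (m : nat) :
  A \subset B -> width_leq B m -> width_leq A m.
Proof. by move=> AB wB S SA; apply: wB; exact: subset_trans AB. Qed.

Lemma width_leq_gt0 (A : {set V}) (a : V) (m : nat) :
  a \in A -> width_leq A m -> 0 < m.
Proof.
move=> aA wA; rewrite -(cards1 a); apply: wA; first by rewrite sub1set.
by apply/antichainP => u v; rewrite !inE => /eqP -> /eqP ->.
Qed.

Lemma width_leq_pred (A : {set V}) (m : nat) : width_leq A m ->
    (forall S : {set V}, S \subset A -> antichain S -> #|S| <> m) ->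
  width_leq A m.-1.
Proof.
move=> wA neqA S SA antiS.
have := wA S SA antiS; rewrite leq_eqVlt => /orP [/eqP /neqA|]; first by case.
by move=> Sm; rewrite -ltnS prednK ?(leq_ltn_trans _ Sm).
Qed.

Definition chain_coloring (A : {set V}) (m : nat) (c : V -> nat) : Prop :=
  {in A, forall v, c v < m} /\
  {in A &, forall u v, c u = c v -> T u v || T v u}.

Lemma chain_coloringU (K A : {set V}) (m : nat) (c : V -> nat) :
  {in K &, total T} -> chain_coloring (A :\: K) m c ->
  chain_coloring A m.+1 (fun v => if v \in K then m else c v).
Proof.
move=> totK [c_lt c_chain].
have c_ltD v : v \in A -> v \notin K -> c v < m.
  by move=> vA vK; rewrite c_lt // inE vK.
split=> [v vA|u v uA vA]; first by case: ifPn => // /(c_ltD v vA)/ltnW.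
case: ifPn => uK; case: ifPn => vK; first by move=> _; exact: totK.
- by move=> e; have := c_ltD v vA vK; rewrite -e ltnn.
- by move=> e; have := c_ltD u uA uK; rewrite e ltnn.
by apply: c_chain; rewrite inE ?uK ?vK.
Qed.

Lemma chain_coloring_onto (A Y : {set V}) (m : nat) (c : V -> nat) :
  chain_coloring A m c -> Y \subset A -> antichain Y -> #|Y| = m ->
  forall i, i < m -> exists2 y, y \in Y & c y = i.
Proof.
move=> [c_lt c_chain] /subsetP YA /antichainP antiY cardY i im.
have m_gt0 : 0 < m by apply: leq_ltn_trans im.
pose f (v : V) : 'I_m := insubd (Ordinal m_gt0) (c v).
have fE : {in Y, forall v, f v = c v :> nat}.
  by move=> v vY; rewrite val_insubd c_lt ?YA.
have f_inj : {in Y &, injective f}.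
  move=> u v uY vY /(congr1 val) /=; rewrite !fE // => cuv.
  by case/orP: (c_chain _ _ (YA _ uY) (YA _ vY) cuv) => /antiY ->.
have: f @: Y == [set: 'I_m].
  by rewrite eqEcard subsetT cardsT card_ord card_in_imset // cardY leqnn.
move/eqP/setP/(_ (Ordinal im)); rewrite in_setT => /imsetP [y yY e].
by exists y => //; rewrite -fE // -e.
Qed.

Lemma chain_has_top (Z : {set V}) (z0 : V) :
  z0 \in Z -> {in Z &, total T} ->
  exists2 x, x \in Z & {in Z, forall z, T z x}.
Proof.
move=> z0Z totZ; case: (arg_maxnP rank z0Z) => x xZ xmax.
by exists x => // z zZ; apply: leq_rank_rel; [exact: totZ | exact: xmax].
Qed.

(* The point [x i] is the top of the points of colour [i] that lie on some
   antichain of [m] elements. *)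
Lemma top_transversal (A Y : {set V}) (m : nat) (c : V -> nat) :
  chain_coloring A m c -> Y \subset A -> antichain Y -> #|Y| = m ->
  exists x : 'I_m -> V, [/\ forall i, x i \in A, forall i, c (x i) = i,
      forall i j, T (x i) (x j) -> i = j
    & forall (S : {set V}) (i : 'I_m), S \subset A -> antichain S -> #|S| = m ->
        exists y, [/\ y \in S, c y = i & T y (x i)]].
Proof.
move=> colA YA antiY cardY.
pose Z (i : 'I_m) := [set z in A | (c z == i) &&
  [exists S : {set V}, [&& S \subset A, antichain S, #|S| == m & z \in S]]].
have ZP (S : {set V}) (i : 'I_m) : S \subset A -> antichain S -> #|S| = m ->
    exists2 y, y \in S & (c y = i) /\ y \in Z i.
  move=> SA antiS cardS.
  have [y yS cy] := chain_coloring_onto colA SA antiS cardS (ltn_ord i).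
  exists y => //; split=> //; rewrite inE (subsetP SA) // cy eqxx /=.
  by apply/existsP; exists S; rewrite SA antiS cardS eqxx.
have /choice [x xP] i : exists x, x \in Z i /\ {in Z i, forall z, T z x}.
  have [y _ [_ yZ]] := ZP Y i YA antiY cardY.
  have [|x] := chain_has_top yZ; last by exists x.
  move=> u v; rewrite !inE => /and3P [uA /eqP cu _] /and3P [vA /eqP cv _].
  by apply: colA.2; rewrite // cu cv.
have xA i : x i \in A by have [] := xP i; rewrite inE => /andP [].
have cx i : c (x i) = i by have [] := xP i; rewrite inE => /and3P [_ /eqP].
have topx (S : {set V}) (i : 'I_m) : S \subset A -> antichain S -> #|S| = m ->
    exists y, [/\ y \in S, c y = i & T y (x i)].
  move=> SA antiS cardS; have [y yS [cy yZ]] := ZP S i SA antiS cardS.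
  by exists y; split=> //; exact: (xP i).2.
exists x; split=> // i j Tij.
have [] := xP j; rewrite inE => /and3P [_ _ /existsP [S]].
case/and4P=> SA antiS /eqP cardS xjS _.
have [y [yS cy Tyx]] := topx S i SA antiS cardS.
have yx : y = x j by move/antichainP: antiS; apply=> //; exact: T_trans Tij.
by apply: val_inj; rewrite /= -cy yx cx.
Qed.

Lemma chain_lowering_width (A : {set V}) (a : V) (m : nat) (c : V -> nat) :
  a \in A -> {in A, forall x, T a x -> T x a} ->
  chain_coloring (A :\ a) m c -> width_leq A m ->
  exists K : {set V},
    [/\ a \in K, {in K &, total T} & width_leq (A :\: K) m.-1].
Proof.
move=> aA amax colA wA; have wA' := width_leqS (subsetDl A [set a]) wA.
have [[Y [YA antiY cardY]]|noY] := pselect (exists Y : {set V},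
    [/\ Y \subset A :\ a, antichain Y & #|Y| = m]); last first.
  exists [set a]; split; rewrite ?set11 //.
    by move=> u v /set1P -> /set1P ->; rewrite T_refl.
  by apply: width_leq_pred => // S SA antiS cardS; apply: noY; exists S.
have [x [xA cx antix topx]] := top_transversal colA YA antiY cardY.
have [[i Txa]|aboveNx] := pselect (exists i, T (x i) a).
  pose L := [set z in A :\ a | (c z == i) && T z (x i)].
  have La u : u \in L -> T u a.
    by rewrite inE => /and3P [_ _ Tux]; exact: T_trans Txa.
  exists (a |: L); split; first exact: setU11.
    move=> u v /setU1P [->|uL] /setU1P [->|vL]; rewrite ?T_refl ?La ?orbT //.
    move: uL vL; rewrite !inE => /and3P [uA /eqP cu _] /and3P [vA /eqP cv _].
    by apply: colA.2; rewrite ?inE // cu cv.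
  rewrite -setDDl; apply: width_leq_pred => [|S SA antiS cardS].
    exact: width_leqS (subsetDl _ _) wA'.
  have SA' := subset_trans SA (subsetDl _ _).
  have [y [yS cy Tyx]] := topx S i SA' antiS cardS.
  have /setDP [yA] := subsetP SA y yS.
  by rewrite inE yA cy eqxx Tyx.
pose X := [set x i | i : 'I_m].
have aNX : {in X, forall v, ~~ T a v && ~~ T v a}.
  move=> _ /imsetP [i _ ->]; have Nxa : ~~ T (x i) a.
    by apply/negP => Txa; apply: aboveNx; exists i.
  by rewrite Nxa andbT; apply: contra Nxa; apply: amax; case/setD1P: (xA i).
have aX : a \notin X by apply/negP => /aNX; rewrite T_refl.
have antiX : antichain X.
  by apply/antichainP => _ _ /imsetP [i _ ->] /imsetP [j _ ->] /antix ->.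
have XA : a |: X \subset A.
  rewrite subUset sub1set aA; apply/subsetP => _ /imsetP [i _ ->].
  by case/setD1P: (xA i).
have := wA _ XA (antichainU1 antiX aNX).
rewrite cardsU1 aX card_imset ?card_ord ?ltnn // => i j e.
by apply: antix; rewrite e.
Qed.

(* Galvin's proof, which works verbatim for preorders. *)
Theorem dilworth (A : {set V}) (m : nat) :
  width_leq A m -> exists c, chain_coloring A m c.
Proof.
have [n] := ubnP #|A|; elim: n A m => // n IH A m; rewrite ltnS => An wA.
have [->|[a0 a0A]] := set_0Vmem A.
  by exists (fun=> 0); split=> [v|u v]; rewrite inE.
case: (@arg_maxnP _ a0 [in A] rank a0A) => a aA amax.
have IHD (K : {set V}) l : a \in K -> width_leq (A :\: K) l ->
    exists c, chain_coloring (A :\: K) l c.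
  move=> aK; apply: IH; apply: leq_trans An; apply/proper_card/properP.
  by split; [exact: subsetDl | exists a => //; rewrite inE aK].
have [c colA] : exists c, chain_coloring (A :\ a) m c.
  by apply: IHD; [exact: set11 | exact: width_leqS (subsetDl _ _) wA].
have [x xA Tax|K [aK totK /(IHD K _ aK) [d colD]]] :=
  chain_lowering_width aA _ colA wA.
  by apply: leq_rank_rel; [rewrite Tax orbT | exact: amax].
rewrite -(prednK (width_leq_gt0 aA wA)).
by exists (fun v => if v \in K then m.-1 else d v); exact: chain_coloringU.
Qed.

End Dilworth.

(** * Combining streaming algorithms *)

Lemma foldl_iotaS (S : Type) (f : S -> nat -> S) (x : S) (j : nat) :
  foldl f x (iota 0 j.+1) = f (foldl f x (iota 0 j)) j.
Proof. by rewrite -addn1 iotaD foldl_cat. Qed.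

Definition parallel (Z : finType) (W I J Ans : Type) (F : algorithm W J Ans)
    (route : Z -> update I -> seq (update J)) :
    algorithm {ffun Z -> W} I (Z -> Ans) :=
  Algorithm [ffun=> start F]
    (fun i st u => [ffun z => foldl (process F i) (st z) (route z u)])
    (fun i st => [ffun z => end_pass F i (st z)])
    (fun st z => output F (st z)).

Lemma run_parallel (Z : finType) (W I J Ans : Type) (F : algorithm W J Ans)
    (route : Z -> update I -> seq (update J)) (q : nat) (s : seq (update I))
    (z : Z) :
  run (parallel F route) q s z = run F q (flatten (map (route z) s)).
Proof.
have processE i st :
    foldl (process (parallel F route) i) st s z =
    foldl (process F i) (st z) (flatten (map (route z) s)).
  by elim: s st => //= u s IH st; rewrite IH ffunE foldl_cat.
rewrite /run /=; congr (output F _).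
elim: q => [|q IH]; first by rewrite ffunE.
by rewrite !foldl_iotaS -IH /run_pass /= ffunE processE.
Qed.

(* Phase [l] occupies the passes [l * q, ..., l * q + q - 1]: it runs [sub l d]
   on the current data [d] and hands its answer to [next]. *)
Definition phased (D W I Ans Out : Type) (q : nat) (d0 : D)
    (sub : nat -> D -> algorithm W I Ans) (next : nat -> D -> Ans -> D)
    (out : D -> Out) : algorithm (D * W) I Out :=
  Algorithm (d0, start (sub 0 d0))
    (fun i st u => (st.1, process (sub (i %/ q) st.1) (i %% q) st.2 u))
    (fun i st =>
       let A := sub (i %/ q) st.1 in
       let w := end_pass A (i %% q) st.2 in
       if (i %% q).+1 == q then
         let d := next (i %/ q) st.1 (output A w) in
         (d, start (sub (i %/ q).+1 d))
       else (st.1, w))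
    (fun st => out st.1).

Lemma run_phased (D W I Ans Out : Type) (q : nat) (d0 : D)
    (sub : nat -> D -> algorithm W I Ans) (next : nat -> D -> Ans -> D)
    (out : D -> Out) (p : nat) (s : seq (update I)) : 0 < q ->
  run (phased q d0 sub next out) p s =
  out (foldl (fun d l => next l d (run (sub l d) q s)) d0 (iota 0 (p %/ q))).
Proof.
move=> q_gt0; set A := phased _ _ _ _ _.
pose data l := foldl (fun d l => next l d (run (sub l d) q s)) d0 (iota 0 l).
have dataS l : data l.+1 = next l (data l) (run (sub l (data l)) q s).
  exact: foldl_iotaS.
have processE i d w :
    foldl (process A i) (d, w) s =
    (d, foldl (process (sub (i %/ q) d) (i %% q)) w s).
  by elim: s w {data dataS} => //= u s IH w; rewrite IH.
suff state i : foldl (run_pass A s) (start A) (iota 0 i) =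
    let B := sub (i %/ q) (data (i %/ q)) in
    (data (i %/ q), foldl (run_pass B s) (start B) (iota 0 (i %% q))).
  by rewrite /run state.
elim: i => [|i IH]; first by rewrite mod0n div0n.
rewrite foldl_iotaS IH /run_pass processE /= -/(run_pass _ s _ (i %% q)).
rewrite -foldl_iotaS.
have SiE : i.+1 = i %/ q * q + (i %% q).+1 by rewrite addnS -divn_eq.
case: ifP => [/eqP e|/negbT ne].
  have runE B : run B q s =
      output B (foldl (run_pass B s) (start B) (iota 0 (i %% q).+1)).
    by rewrite e.
  have {}SiE : i.+1 = (i %/ q).+1 * q by rewrite SiE e mulSnr.
  by rewrite SiE mulnK // modnMl dataS runE.
have lt : (i %% q).+1 < q by rewrite ltn_neqAle ne ltn_pmod.
by rewrite SiE divnMDl // modnMDl (divn_small lt) (modn_small lt) addn0.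
Qed.

Lemma algorithm_transport (St Mem I Ans Ans' : Type) (f : St -> Mem)
    (g : Mem -> St) (h : Ans -> Ans') (A : algorithm St I Ans) :
  cancel f g ->
  exists B : algorithm Mem I Ans', forall p s, run B p s = h (run A p s).
Proof.
move=> fK.
exists (Algorithm (f (start A)) (fun i m u => f (process A i (g m) u))
  (fun i m => f (end_pass A i (g m))) (fun m => h (output A (g m)))) => p s.
set B := Algorithm _ _ _ _.
have processE i st :
    foldl (process B i) (f st) s = f (foldl (process A i) st s).
  by elim: s st => //= u s IH st; rewrite fK IH.
have passE r st :
    foldl (run_pass B s) (f st) r = f (foldl (run_pass A s) st r).
  by elim: r st => //= i r IH st; rewrite /run_pass processE /= fK IH.
by rewrite /run passE /= fK.
Qed.

(** * Minimum of a streamed multiset *)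

(* [dflt] stands for the minimum of the empty set; it is meant to exceed all
   values of [h]. *)
Definition is_min (X : Type) (dflt : nat) (A : pred X) (h : X -> nat)
    (t : nat) : Prop :=
  (forall x, A x -> t <= h x) /\ (t = dflt \/ exists2 x, A x & t = h x).

(* [f] is the final content of the stream, a multiset of size at most [N]. *)
Definition finds_min (M : stream_model) (W : Type) (m N q : nat)
    (F : algorithm W 'I_m nat) : Prop :=
  forall (s : seq (update 'I_m)) (f : 'I_m -> nat),
    (M = InsertionOnly -> forall u, u \in s -> u.1) ->
    (forall r, count_mem (true, r) s = count_mem (false, r) s + f r) ->
    \sum_r f r <= N ->
    is_min m [pred r | 0 < f r] (@nat_of_ord m) (run F q s).

Definition insertion_finder (m : nat) : algorithm 'I_m.+1 'I_m nat :=
  Algorithm ord_max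
    (fun _ t (u : update 'I_m) =>
       if u.2 < t then widen_ord (leqnSn m) u.2 else t)
    (fun _ t => t) (@nat_of_ord _).

Lemma run_insertion_finder (m : nat) (s : seq (update 'I_m)) :
  is_min m [in s] (fun u => u.2 : nat) (run (insertion_finder m) 1 s).
Proof.
elim/last_ind: s => [|s u [ge_min min_in]]; first by split=> //; left.
rewrite /run /run_pass /= foldl_rcons -/(process _ 0).
set t := foldl _ _ _ in ge_min min_in *.
have t_le : t <= m by rewrite -ltnS.
split=> [v|] /=.
  rewrite mem_rcons inE => /predU1P [->|/ge_min].
    by case: ltnP => //= /ltnW.
  by case: ltnP => //= /ltnW; exact: leq_trans.
case: ltnP => [ut|].
  by right; exists u; rewrite ?mem_rcons ?inE ?eqxx.
case: min_in => [|[v vs tE]]; first by left.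
by right; exists v; rewrite ?mem_rcons ?inE ?vs ?orbT.
Qed.

Lemma insertion_finderP (m N : nat) :
  finds_min InsertionOnly N 1 (insertion_finder m).
Proof.
move=> s f /(_ erefl) ins cnt _.
have fE r : (0 < f r) = ((true, r) \in s).
  rewrite -has_pred1 has_count cnt (count_memPn _) //.
  by apply/negP => /ins.
have [ge_min min_in] := run_insertion_finder s.
split=> [r|]; first by rewrite /= fE => /ge_min.
case: min_in => [|[u us tE]]; first by left.
by right; exists u.2; rewrite //= fE -(ins _ us) -surjective_pairing.
Qed.

Lemma count_by_value (J : finType) (P : pred J) (s : seq (update J))
    (sg : bool) :
  count (fun u : update J => (u.1 == sg) && P u.2) s =
  \sum_(r | P r) count_mem (sg, r) s.
Proof.
elim: s => [|[sg' r'] s IH] /=; first by rewrite big1.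
rewrite IH big_split /=; congr addn.
under eq_bigr => r _ do rewrite xpair_eqE eq_sym [r' == r]eq_sym -mulnb.
rewrite -big_distrr /= eq_sym -mulnb big_mkcond (bigD1 r') //= eqxx.
by rewrite big1 ?addn0 => [|r /negbTE ->]; case: (P _).
Qed.

Section SearchFinder.
Variables (b m N q : nat).

(* Before pass [j] the state holds the quotient of the minimum by
   [b.+1 ^ (q - j)], or [None] if the stream was found to be empty; during the
   pass, counters modulo [N.+1] are kept for the [b.+1] subintervals of the
   corresponding interval. *)
Definition search_state : finType :=
  (option 'I_m.+1 * {ffun 'I_b.+1 -> 'I_N.+1})%type.

Definition in_slot (j : nat) (a : option 'I_m.+1) (i : 'I_b.+1) (r : nat) :
    bool :=
  if a is Some a0 then
    (r %/ b.+1 ^ (q - j) == a0) && ((r %/ b.+1 ^ (q - j.+1)) %% b.+1 == i)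
  else false.

(* A deletion adds [N], which is [-1] modulo [N.+1]. *)
Definition count_update (sg : bool) (c : 'I_N.+1) : 'I_N.+1 :=
  inord ((c + (if sg then 1 else N)) %% N.+1).

Definition first_nonzero (ct : {ffun 'I_b.+1 -> 'I_N.+1}) : option 'I_b.+1 :=
  [pick i | (0 < ct i) && [forall k : 'I_b.+1, (k < i) ==> (ct k == ord0)]].

Definition search_finder : algorithm search_state 'I_m.+1 nat :=
  Algorithm (Some ord0, [ffun=> ord0])
    (fun j w (u : update 'I_m.+1) =>
       (w.1, [ffun i => if in_slot j w.1 i u.2 then count_update u.1 (w.2 i)
                        else w.2 i]))
    (fun j w =>
       (if (w.1, first_nonzero w.2) is (Some a, Some i) then
          insub (a * b.+1 + i)
        else None, [ffun=> ord0]))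
    (fun w => if w.1 is Some a then nat_of_ord a else m.+1).

Lemma first_nonzero_eq (ct : {ffun 'I_b.+1 -> 'I_N.+1}) (i : 'I_b.+1) :
  0 < ct i -> (forall k : 'I_b.+1, k < i -> ct k = ord0) ->
  first_nonzero ct = Some i.
Proof.
move=> cti ct0; rewrite /first_nonzero; case: pickP => [k|/(_ i)]; last first.
  rewrite cti => /negbT/forallPn [k]; rewrite negb_imply => /andP [/ct0 ->].
  by rewrite eqxx.
case/andP=> ctk /forallP kmin; congr Some; apply: val_inj => /=.
case: (ltngtP k i) => // [/ct0 e|lt]; first by move: ctk; rewrite e.
by have := kmin i; rewrite lt /= => /eqP e; move: cti; rewrite e.
Qed.

Lemma search_count (j : nat) (s : seq (update 'I_m.+1)) (w : search_state) :
  let w' := foldl (process search_finder j) w s in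
  w'.1 = w.1 /\ forall i, w'.2 i =
    (w.2 i
     + count (fun u : update 'I_m.+1 => u.1 && in_slot j w.1 i u.2) s
     + N * count (fun u : update 'I_m.+1 => ~~ u.1 && in_slot j w.1 i u.2) s)
      %% N.+1 :> nat.
Proof.
elim: s w => [|u s IH] w /=.
  by split=> // i; rewrite muln0 !addn0 modn_small.
have [-> cnt] := IH (process search_finder j w u).
split=> // i; rewrite cnt /= ffunE.
case: ifP => slot; last by rewrite !andbF.
rewrite !andbT /count_update inordK ?ltn_pmod // -addnA modnDml.
by congr (_ %% _); case: u.1 => /=; lia.
Qed.

Section Stream.
Variables (s : seq (update 'I_m.+1)) (f : 'I_m.+1 -> nat).
Hypothesis count_content : forall r,
  count_mem (true, r) s = count_mem (false, r) s + f r.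
Hypothesis sum_content : \sum_r f r <= N.

Lemma search_pass_count (j : nat) (a : option 'I_m.+1) (i : 'I_b.+1) :
  (foldl (process search_finder j) (a, [ffun=> ord0]) s).2 i =
  \sum_(r : 'I_m.+1 | in_slot j a i r) f r :> nat.
Proof.
have [_ ->] := search_count j s (a, [ffun=> ord0]).
rewrite /= ffunE /= add0n; pose slot (r : 'I_m.+1) := in_slot j a i r.
rewrite (@eq_count _ _ (fun u => (u.1 == true) && slot u.2));
  last by case=> -[].
rewrite [X in N * X](@eq_count _ _ (fun u => (u.1 == false) && slot u.2));
  last by case=> -[].
rewrite !count_by_value; under eq_bigr => r _ do rewrite count_content.
rewrite big_split /=; set x := \sum_(r | _) count_mem _ s.
set y := \sum_(r | _) f r; have -> : x + y + N * x = x * N.+1 + y by lia.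
rewrite modnMDl modn_small // ltnS; apply: leq_trans sum_content.
by rewrite [leqRHS](bigID slot) leq_addr.
Qed.

Lemma search_pass_empty (j : nat) (a : option 'I_m.+1) :
  (forall r, f r = 0) ->
  (run_pass search_finder s (a, [ffun=> ord0]) j).1 = None.
Proof.
move=> f0; rewrite /run_pass /=; set w := foldl _ _ _.
rewrite [first_nonzero w.2](_ : _ = None); first by case: w.1.
rewrite /first_nonzero; case: pickP => // i /andP [].
by rewrite search_pass_count big1.
Qed.

Lemma search_pass_min (t : 'I_m.+1) (j : nat) (a : option 'I_m.+1) :
  0 < f t -> (forall r, 0 < f r -> t <= r) -> j < q ->
  omap val a = Some (t %/ b.+1 ^ (q - j)) ->
  omap val (run_pass search_finder s (a, [ffun=> ord0]) j).1 =
  Some (t %/ b.+1 ^ (q - j.+1)).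
Proof.
move=> ft tmin jq; case: a => // a [aE].
have [/= w1 _] := search_count j s (Some a, [ffun=> ord0]).
rewrite /run_pass /= w1; have := search_pass_count j (Some a).
move: (foldl _ _ _).2 => {w1} ct ctE; set B := b.+1 ^ (q - j.+1).
have BE : b.+1 ^ (q - j) = B * b.+1 by rewrite -expnSr -subSn.
have {}aE : a = t %/ B %/ b.+1 :> nat by rewrite -divnMA -BE.
pose i : 'I_b.+1 := inord ((t %/ B) %% b.+1).
have iE : i = (t %/ B) %% b.+1 :> nat by rewrite inordK // ltn_pmod.
have tslot : in_slot j (Some a) i t by rewrite /= -/B BE divnMA aE iE !eqxx.
rewrite (@first_nonzero_eq _ i) => [| |k ki].
- by rewrite iE aE -divn_eq insubT ?(leq_ltn_trans (leq_div _ _)).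
- by rewrite ctE (bigD1 t) //= addn_gt0 ft.
apply: val_inj; rewrite /= ctE big1 // => r /andP [/eqP ra /eqP rk].
apply/eqP; rewrite -leqn0 leqNgt; apply/negP => /tmin tr.
have := leq_div2r B tr; rewrite (divn_eq (t %/ B) b.+1) (divn_eq (r %/ B) b.+1).
by rewrite -aE -divnMA -BE ra rk leq_add2l -iE leqNgt ki.
Qed.

End Stream.

Lemma search_finderP (M : stream_model) :
  0 < q -> m.+1 <= b.+1 ^ q -> finds_min M N q search_finder.
Proof.
move=> q_gt0 m_lt s f _ cnt fN.
pose st j := foldl (run_pass search_finder s) (start search_finder) (iota 0 j).
have stS j : st j.+1 = run_pass search_finder s ((st j).1, [ffun=> ord0]) j.
  rewrite /st foldl_iotaS; congr run_pass; rewrite [LHS]surjective_pairing.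
  by congr pair; case: j => [|j]; rewrite ?foldl_iotaS.
rewrite -[run _ _ _]/(output search_finder (st q)) /=.
have [[r0 fr0]|f0] := pselect (exists r, 0 < f r); last first.
  have {}f0 r : f r = 0.
    by apply/eqP; rewrite -leqn0 leqNgt; apply/negP => fr; apply: f0; exists r.
  rewrite -(prednK q_gt0) stS (search_pass_empty cnt fN _ _ f0).
  by split=> [r|]; [rewrite /= f0 | left].
case: (@arg_minnP _ r0 (fun r => 0 < f r) (@nat_of_ord _) fr0) => t ft tmin.
have st1 j : j <= q -> omap val (st j).1 = Some (t %/ b.+1 ^ (q - j)).
  elim: j => [_|j IH jq]; last first.
    by rewrite stS; exact: (search_pass_min cnt fN) (IH (ltnW jq)).
  by rewrite /= subn0 divn_small //; apply: leq_trans m_lt.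
have := st1 q (leqnn q); rewrite subnn expn0 divn1.
by case: (st q).1 => //= _ [->]; split=> //; right; exists t.
Qed.

End SearchFinder.

(** * Closures of blocks *)

Lemma independent_leq (V : finType) (G : digraph V) (S : {set V}) :
  independent G S -> #|S| <= independence_number G.
Proof. by move=> iS; rewrite /independence_number (bigmax_sup S). Qed.

Definition block_arc (V : finType) (block : V -> nat) (G : digraph V) : rel V :=
  [rel u v | arc G u v && (block u == block v)].

Definition block_closure (V : finType) (block : V -> nat) (G : digraph V) :
    rel V :=
  connect (block_arc block G).

Lemma block_closure1 (V : finType) (block : V -> nat) (G : digraph V)
    (u v : V) :
  arc G u v -> block u = block v -> block_closure block G u v.
Proof. by move=> uv e; apply: connect1; apply/andP; split=> //; apply/eqP. Qed.

Section ChainTables.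
Variables (V : finType) (block : V -> nat) (alpha : nat).

(* A preorder inside the blocks is stored as a chain colouring, a rank that is
   monotone along the chains and, for each node and colour, the least rank of
   the nodes of that colour that the node reaches. *)
Definition tables : finType :=
  ({ffun V -> 'I_alpha} * {ffun V -> 'I_#|V|.+1} *
   {ffun V * 'I_alpha -> 'I_#|V|.+2})%type.

Definition table_color (tb : tables) : V -> 'I_alpha := tb.1.1.
Definition table_rank (tb : tables) : V -> 'I_#|V|.+1 := tb.1.2.

Definition decode (tb : tables) : rel V :=
  [rel u w | (block u == block w)
             && (tb.2 (u, table_color tb w) <= table_rank tb w)].

Definition encodes (tb : tables) (T : rel V) : Prop :=
  decode tb = T /\
  forall u w, block u = block w -> table_color tb u = table_color tb w ->
    table_rank tb u <= table_rank tb w -> T u w.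

Section Existence.
Variable T : rel V.
Hypotheses (T_refl : reflexive T) (T_trans : transitive T).
Hypothesis T_block : forall u v, T u v -> block u = block v.

Lemma block_chain_coloring : 0 < alpha ->
    (forall i, width_leq T [set v | block v == i] alpha) ->
  exists c : V -> 'I_alpha,
    forall u v, block u = block v -> c u = c v -> T u v || T v u.
Proof.
move=> alpha_gt0 widthT.
have /choice [c colc] i :
    exists c, chain_coloring T [set v | block v == i] alpha c.
  exact: dilworth.
exists (fun v => insubd (Ordinal alpha_gt0) (c (block v) v)) => u v uv.
have [c_lt c_chain] := colc (block u).
move/(congr1 val); rewrite /= !val_insubd -uv !c_lt ?inE ?uv ?eqxx // => cuv.
by apply: c_chain; rewrite ?inE ?uv ?eqxx // -uv.
Qed.

Lemma least_reached_rank (c : V -> 'I_alpha) (u : V) (j : 'I_alpha) :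
  (forall u v, block u = block v -> c u = c v -> T u v || T v u) ->
  exists t : 'I_#|V|.+2,
    forall w, c w = j -> block u = block w -> (t <= rank T w) = T u w.
Proof.
move=> c_chain.
have [[w0 Tw0 cw0]|none] := pselect (exists2 w, T u w & c w = j).
  have Tcw0 : T u w0 && (c w0 == j) by rewrite Tw0 cw0 eqxx.
  case: (@arg_minnP _ w0 (fun w => T u w && (c w == j)) (rank T) Tcw0).
  move=> w1 /andP [Tuw1 /eqP cw1] w1min.
  exists (widen_ord (leqnSn _) (Ordinal (rank_lt T w1))) => w cw uw /=.
  apply/idP/idP => [le|Tuw]; last by apply: w1min; rewrite Tuw cw eqxx.
  apply: (T_trans Tuw1); apply: leq_rank_rel le => //.
  by apply: c_chain; rewrite ?cw // -(T_block Tuw1).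
exists ord_max => w cw _ /=; rewrite leqNgt rank_lt /=; apply/esym/negbTE.
by apply/negP => Tuw; apply: none; exists w.
Qed.

Lemma encodes_exists : 0 < alpha ->
    (forall i, width_leq T [set v | block v == i] alpha) ->
  exists tb, encodes tb T.
Proof.
move=> alpha_gt0 /(block_chain_coloring alpha_gt0) [c c_chain].
have /choice [reach reachP] : forall z : V * 'I_alpha, exists t : 'I_#|V|.+2,
    forall w, c w = z.2 -> block z.1 = block w -> (t <= rank T w) = T z.1 w.
  by move=> [u j]; exact: least_reached_rank.
exists ([ffun v => c v], [ffun v => Ordinal (rank_lt T v)],
        [ffun z => reach z]); split; last first.
  move=> u w; rewrite /table_color /table_rank /= !ffunE => uw cuw.
  by apply: leq_rank_rel => //; exact: c_chain.
apply/funeq2P => u w; rewrite /decode /table_color /table_rank /= !ffunE /=.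
case: eqP => [uw|/eqP neq_uw] /=; first by rewrite reachP.
by apply/esym/negbTE; apply: contra neq_uw => /T_block ->.
Qed.

End Existence.

Lemma block_closure_block (G : digraph V) (u v : V) :
  block_closure block G u v -> block u = block v.
Proof.
case/connectP=> p; elim: p u => [|w p IH] u /=; first by move=> _ ->.
by case/andP=> /andP [_ /eqP ->] /IH{}IH /IH.
Qed.

Lemma width_block_closure (G : digraph V) (i : nat) :
  width_leq (block_closure block G) [set v | block v == i]
    (independence_number G).
Proof.
move=> S /subsetP Si /antichainP antiS; apply: independent_leq.
have nonarc x y : x \in S -> y \in S -> x != y -> ~~ arc G x y.
  move=> xS yS; apply: contra => xy; apply/eqP; apply: antiS => //.
  apply: block_closure1 => //.
  by have := Si _ xS; have := Si _ yS; rewrite !inE => /eqP -> /eqP ->.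
apply/forall_inP => u uS; apply/forall_inP => v vS; apply/implyP => uv.
by rewrite /underlying /= negb_or !nonarc // eq_sym.
Qed.

Hypothesis alpha_gt0 : 0 < alpha.

Definition encode (T : rel V) : tables :=
  xget ([ffun=> Ordinal alpha_gt0], [ffun=> ord0], [ffun=> ord0])
    [set tb | encodes tb T]%classic.

Lemma encodeP (G : digraph V) : independence_number G <= alpha ->
  encodes (encode (block_closure block G)) (block_closure block G).
Proof.
move=> G_alpha; apply: (@xgetPex _ _ [set tb | encodes tb _]%classic).
apply: encodes_exists => //; first exact: connect0.
- by move=> v u w; exact: connect_trans.
- exact: block_closure_block.
by move=> i S Si /(width_block_closure Si) /leq_trans; exact.
Qed.

End ChainTables.

Section MergeBlocks.
Variables (V : finType) (k alpha : nat).
Variables (fine coarse : V -> nat) (sub : V -> 'I_k).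
Hypotheses
  (fine_coarse : forall u v, fine u = fine v -> coarse u = coarse v)
  (coarse_sub_fine :
     forall u v, coarse u = coarse v -> sub u = sub v -> fine u = fine v).
Variable tb : tables V alpha.

(* A cell [(u, i, j)] looks for the first out-neighbour of [u] on the chain of
   colour [j] of the [i]-th fine block in the coarse block of [u]. *)
Definition cell : finType := (V * 'I_k * 'I_alpha)%type.

Definition cell_target (z : cell) (w : V) : bool :=
  [&& z.1.1 != w, coarse z.1.1 == coarse w, sub w == z.1.2
    & table_color tb w == z.2].

Definition merge (t : cell -> nat) : rel V :=
  connect [rel u w | decode fine tb u w ||
    (coarse u == coarse w) &&
    (t (u, sub w, table_color tb w) == table_rank tb w)].

Variables (G : digraph V) (t : cell -> nat).
Hypotheses
  (tbG : encodes fine tb (block_closure fine G))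
  (loopless : forall u, ~~ arc G u u)
  (tP : forall z : cell, is_min #|V|.+1
     [pred w | cell_target z w && arc G z.1.1 w] (table_rank tb) (t z)).

Lemma fine_sub_coarse :
  subrel (block_closure fine G) (block_closure coarse G).
Proof.
apply: connect_sub => u v /andP [uv /eqP fine_uv].
by apply: block_closure1 => //; exact: fine_coarse.
Qed.

Lemma merge_sub_closure : subrel (merge t) (block_closure coarse G).
Proof.
case: tbG => decE chainG; apply: connect_sub => u v.
case/orP=> [|/andP [/eqP uv /eqP tE]].
  by rewrite decE; exact: fine_sub_coarse.
case: (tP (u, sub v, table_color tb v)).2 => [|[w /andP [zw uw] rw]].
  by rewrite tE => e; have := ltn_ord (table_rank tb v); rewrite e ltnn.
case/and4P: zw => /= _ /eqP coarse_uw /eqP sub_wv /eqP color_wv.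
apply: connect_trans (block_closure1 uw coarse_uw) _.
apply: fine_sub_coarse; apply: chainG; rewrite -?rw ?tE //.
by apply: coarse_sub_fine => //; rewrite -coarse_uw.
Qed.

Lemma closure_sub_merge : subrel (block_closure coarse G) (merge t).
Proof.
case: tbG => decE chainG; apply: connect_sub => u v /andP [uv /eqP coarse_uv].
pose z : cell := (u, sub v, table_color tb v).
have zv : cell_target z v.
  rewrite /cell_target /= coarse_uv !eqxx !andbT.
  by apply: contraTneq uv => ->; exact: loopless.
have [/(_ v) /= t_min t_in] := tP z.
move: t_min; rewrite zv uv => /(_ isT) t_min.
case: t_in => [e|[w /andP [zw uw] tE]].
  by have := leq_ltn_trans t_min (ltn_ord _); rewrite e ltnn.
case/and4P: zw => /= _ /eqP coarse_uw /eqP sub_wv /eqP color_wv.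
apply: (@connect_trans _ _ w); apply: connect1 => /=.
  by rewrite coarse_uw eqxx sub_wv color_wv -/z tE eqxx orbT.
rewrite [decode _ _]decE chainG //; last by rewrite -tE.
by apply: coarse_sub_fine => //; rewrite -coarse_uw.
Qed.

(* Besides the arcs inside the fine blocks, the arc from a node to its first
   out-neighbour on a chain suffices, as the further ones are reachable from
   the first. *)
Lemma merge_closure : merge t = block_closure coarse G.
Proof.
apply/funeq2P => u v.
by apply/idP/idP; [exact: merge_sub_closure | exact: closure_sub_merge].
Qed.

End MergeBlocks.

(** * Streaming the transitive closure *)

(* Both kinds of input are digraphs whose arc [e] is carried by the item
   [item_of e]; a clause carries two arcs. *)
Definition arc_graph (I V : finType) (item_of : V * V -> I) (X : {set I}) :
    digraph V :=
  [set e | (e.1 != e.2) && (item_of e \in X)].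

Lemma arc_graph_loopless (I V : finType) (item_of : V * V -> I) (X : {set I})
    (u : V) :
  ~~ arc (arc_graph item_of X) u u.
Proof. by rewrite /arc /= inE eqxx. Qed.

Section CellStreams.
Variables (I V : finType) (item_of : V * V -> I) (k alpha : nat).
Variables (coarse : V -> nat) (sub : V -> 'I_k) (tb : tables V alpha).

Definition cell_updates (z : cell V k alpha) (u : update I) :
    seq (update 'I_#|V|.+1) :=
  [seq (u.1, table_rank tb w) | w <- enum V &
     cell_target coarse sub tb z w && (item_of (z.1.1, w) == u.2)].

Lemma count_cell_updates (z : cell V k alpha) (s : seq (update I)) (sg : bool)
    (r : 'I_#|V|.+1) :
  count_mem (sg, r) (flatten (map (cell_updates z) s)) =
  \sum_(w | cell_target coarse sub tb z w && (table_rank tb w == r))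
     count_mem (sg, item_of (z.1.1, w)) s.
Proof.
elim: s => [|[sg' x] s IH] /=; first by rewrite big1.
rewrite count_cat IH big_split /=; congr addn.
rewrite count_map count_filter -sum1_count big_enum_cond big_mkcond.
rewrite [RHS]big_mkcond /=; apply: eq_bigr => w _.
rewrite /= !xpair_eqE (eq_sym x).
by case: cell_target; case: (table_rank tb w == r); case: (sg' == sg);
   case: (_ == x).
Qed.

Lemma finds_min_cell (M : stream_model) (W : Type) (q : nat)
    (F : algorithm W 'I_#|V|.+1 nat) (adm : pred I) (X : {set I})
    (s : seq (update I)) (z : cell V k alpha) :
  finds_min M #|V| q F -> is_stream M adm X s ->
  is_min #|V|.+1
    [pred w | cell_target coarse sub tb z w
              && arc (arc_graph item_of X) z.1.1 w]
    (table_rank tb) (run F q (flatten (map (cell_updates z) s))).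
Proof.
move=> Fmin [_ ins _ cnt].
pose tgt := cell_target coarse sub tb z.
pose f r := \sum_(w | tgt w && (table_rank tb w == r))
  (item_of (z.1.1, w) \in X : nat).
have f_gt0 r : (0 < f r) =
    [exists w, [&& tgt w, table_rank tb w == r & item_of (z.1.1, w) \in X]].
  rewrite lt0n sum_nat_eq0 negb_forall; apply: eq_existsb => w.
  by rewrite negb_imply; case: (_ \in X); rewrite ?andbT ?andbF.
have arcE w : tgt w ->
    arc (arc_graph item_of X) z.1.1 w = (item_of (z.1.1, w) \in X).
  by rewrite /arc /= inE /= => /and4P [->].
have [] := Fmin (flatten (map (cell_updates z) s)) f.
- move=> M_ins u /flattenP [_ /mapP [u' u's ->] /mapP [w _ ->]] /=.
  exact: ins.
- move=> r; rewrite !count_cell_updates /f -big_split /=.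
  by apply: eq_bigr => w _; exact: cnt.
- rewrite /f (exchange_big_dep tgt) /=; last by move=> r w _ /andP [].
  rewrite -[leqRHS]sum1_card big_mkcond /=; apply: leq_sum => w _.
  case: ifP => // tgt_w; rewrite (big_pred1 (table_rank tb w)) ?leq_b1 //.
  by move=> r; rewrite tgt_w eq_sym.
move=> t_min t_in; split=> [w /andP [tgt_w]|].
  rewrite arcE // => wX; apply: t_min; rewrite /= f_gt0; apply/existsP.
  by exists w; rewrite /tgt tgt_w wX eqxx.
case: t_in => [->|[r]]; first by left.
rewrite /= f_gt0 => /existsP [w /and3P [tgt_w /eqP <- wX]] tE; right.
by exists w => //=; rewrite arcE // wX andbT.
Qed.

End CellStreams.

Section LevelBlocks.
Variables (V : finType) (k : nat).

Definition level_block (l : nat) (v : V) : nat := enum_rank v %/ k ^ l.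

Hypothesis k_gt0 : 0 < k.

Definition level_subblock (l : nat) (v : V) : 'I_k :=
  Ordinal (ltn_pmod (level_block l v) k_gt0).

Lemma level_block0_inj : injective (level_block 0).
Proof.
by move=> u v; rewrite /level_block !divn1 => /val_inj /enum_rank_inj.
Qed.

Lemma level_blockS (l : nat) (v : V) :
  level_block l.+1 v = level_block l v %/ k.
Proof. by rewrite /level_block expnSr divnMA. Qed.

Lemma level_block_coarse (l : nat) (u v : V) :
  level_block l u = level_block l v -> level_block l.+1 u = level_block l.+1 v.
Proof. by rewrite !level_blockS => ->. Qed.

Lemma level_block_fine (l : nat) (u v : V) :
  level_block l.+1 u = level_block l.+1 v ->
  level_subblock l u = level_subblock l v -> level_block l u = level_block l v.
Proof.
rewrite !level_blockS => e /(congr1 val) /= e'.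
by rewrite (divn_eq (level_block l u) k) e e' -divn_eq.
Qed.

Lemma level_block_top (l : nat) (v : V) : #|V| <= k ^ l -> level_block l v = 0.
Proof.
by move=> le; rewrite /level_block divn_small ?(leq_trans (ltn_ord _)).
Qed.

End LevelBlocks.

Section ClosureAlgorithm.
Variables (I V : finType) (item_of : V * V -> I) (k alpha q : nat).
Hypotheses (k_gt0 : 0 < k) (alpha_gt0 : 0 < alpha) (q_gt0 : 0 < q).
Variables (W : finType) (F : algorithm W 'I_#|V|.+1 nat).

Definition closure_state : finType :=
  (tables V alpha * {ffun cell V k alpha -> W})%type.

Definition closure_step (l : nat) (tb : tables V alpha)
    (t : cell V k alpha -> nat) : tables V alpha :=
  encode (level_block k l.+1) alpha_gt0
    (merge (level_block k l) (level_block k l.+1) (level_subblock k_gt0 l)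
       tb t).

Definition closure_algorithm (p : nat) : algorithm closure_state I (rel V) :=
  phased q (encode (level_block k 0) alpha_gt0 eq_op)
    (fun l tb => parallel F
       (cell_updates item_of (level_block k l.+1) (level_subblock k_gt0 l) tb))
    closure_step (fun tb => decode (level_block k (p %/ q)) tb).

Lemma closure_algorithmP (M : stream_model) (adm : pred I) (X : {set I})
    (s : seq (update I)) (p : nat) :
  finds_min M #|V| q F -> #|V| <= k ^ (p %/ q) -> is_stream M adm X s ->
  independence_number (arc_graph item_of X) <= alpha ->
  run (closure_algorithm p) p s = connect (arc (arc_graph item_of X)).
Proof.
move=> Fmin V_le strm X_alpha; rewrite run_phased //.
pose G := arc_graph item_of X; set step := fun tb l => _.
have stepP l : encodes (level_block k l)
    (foldl step (encode (level_block k 0) alpha_gt0 eq_op) (iota 0 l))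
    (block_closure (level_block k l) G).
  elim: l => [|l IH].
    suff -> : eq_op = block_closure (level_block k 0) G by exact: encodeP.
    apply/funeq2P => u v; apply/eqP/idP => [->|]; first exact: connect0.
    by move/block_closure_block/level_block0_inj.
  rewrite foldl_iotaS /step /closure_step (merge_closure _ _ IH).
  - exact: encodeP.
  - exact: level_block_coarse.
  - exact: level_block_fine.
  - exact: arc_graph_loopless.
  by move=> z; rewrite run_parallel; exact: finds_min_cell strm.
rewrite (stepP _).1; apply/funeq2P => u v; apply: eq_connect => {}u {}v.
by rewrite /block_arc /= !level_block_top // andbT.
Qed.

End ClosureAlgorithm.

(** * Space *)

Lemma leq_wexp2r (m n e : nat) : m <= n -> m ^ e <= n ^ e.
Proof. by case: e => // e; rewrite leq_exp2r. Qed.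

Lemma card_closure_state (V W : finType) (k alpha w : nat) :
  alpha <= #|V| -> #|W| <= #|V|.+2 ^ w ->
  #|closure_state V k alpha W| <=
  #|V|.+2 ^ (#|V| * (2 + alpha + w * k * alpha)).
Proof.
move=> alpha_le W_le; rewrite !card_prod !card_ffun !card_prod !card_ord.
have -> : #|V| * (2 + alpha + w * k * alpha) =
  #|V| + #|V| + #|V| * alpha + w * (#|V| * k * alpha) by lia.
rewrite !expnD (expnM _ w); apply: leq_mul; last exact: leq_wexp2r.
by apply: leq_mul => //; apply: leq_mul; apply: leq_wexp2r; lia.
Qed.

Lemma memory_embedding (n S : nat) (St : finType) (st0 : St) :
  #|St| <= n.+1 ^ S ->
  exists (f : St -> memory n S) (g : memory n S -> St), cancel f g.
Proof.
move=> le; pose Mem : finType := S.-tuple (((trunc_log 2 n).+1).-tuple bool).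
have leMem : #|St| <= #|Mem|.
  rewrite !card_tuple card_bool; apply: leq_trans le _.
  by apply: leq_wexp2r; exact: trunc_log_ltn.
exists (fun st => enum_val (widen_ord leMem (enum_rank st)) : Mem).
exists (fun y : Mem => if insub (enum_rank y : nat) : option 'I_#|St| is Some i
                       then enum_val i else st0) => st.
by rewrite enum_valK /= valK enum_rankK.
Qed.

Definition solvable_in_words (M : stream_model) (P : problem)
    (p n alpha S : nat) : Prop :=
  exists A : algorithm (memory n S) (item P n) (answer P n),
  forall (X : {set item P n}) (s : seq (update (item P n))),
    promise X -> parameter X <= alpha ->
    is_stream M (@admissible P n) X s -> correct X (run A p s).

Lemma solvable_in_words_of_states (M : stream_model) (P : problem)
    (p n alpha S : nat) (St : finType) (Ans : Type)
    (A : algorithm St (item P n) Ans) (ans : Ans -> answer P n) :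
  #|St| <= n.+1 ^ S ->
  (forall (X : {set item P n}) (s : seq (update (item P n))),
    promise X -> parameter X <= alpha -> is_stream M (@admissible P n) X s ->
    correct X (ans (run A p s))) ->
  solvable_in_words M P p n alpha S.
Proof.
move=> /(memory_embedding (start A)) [f [g fK]] ansP.
have [B BE] := algorithm_transport ans A fK; exists B => X s prX X_alpha strm.
by rewrite BE; exact: ansP.
Qed.

Lemma solvable_by_constant (M : stream_model) (P : problem) (p n alpha : nat)
    (a : answer P n) :
  (forall (X : {set item P n}) (s : seq (update (item P n))),
    promise X -> parameter X <= alpha -> is_stream M (@admissible P n) X s ->
    correct X a) ->
  solvable_in_words M P p n alpha 0.
Proof.
move=> aP; pose A : algorithm unit (item P n) (answer P n) :=
  Algorithm tt (fun _ _ _ => tt) (fun _ _ => tt) (fun=> a).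
apply: (solvable_in_words_of_states (A := A) (ans := id)); last exact: aP.
by rewrite card_unit.
Qed.

Definition closure_determined (P : problem) (n : nat) : Prop :=
  exists (V : finType) (item_of : V * V -> item P n), [/\ #|V| <= 2 * n,
    forall T : rel V, exists a, forall X : {set item P n},
      (forall x, x \in X -> admissible x) -> promise X ->
      connect (arc (arc_graph item_of X)) = T -> correct X a
  & forall X : {set item P n}, (forall x, x \in X -> admissible x) ->
      independence_number (arc_graph item_of X) <= parameter X].

Lemma stream_admissible (M : stream_model) (I : finType) (adm : pred I)
    (X : {set I}) (s : seq (update I)) :
  is_stream M adm X s -> forall x, x \in X -> adm x.
Proof.
case=> admP _ _ cnt x xX; apply: (admP (true, x)).
by rewrite -has_pred1 has_count cnt xX addn1.
Qed.

Lemma independence_number_gt0 (V : finType) (G : digraph V) (v : V) :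
  0 < independence_number G.
Proof.
rewrite -(cards1 v); apply/independent_leq/forall_inP => _ /set1P ->.
by apply/forall_inP => _ /set1P ->; rewrite eqxx.
Qed.

Lemma independence_number_max (V : finType) (G : digraph V) :
  independence_number G <= #|V|.
Proof. by apply/bigmax_leqP => S _; exact: max_card. Qed.

Lemma closure_determined_solvable (M : stream_model) (P : problem)
    (p n alpha k q w : nat) :
  closure_determined P n -> 0 < k -> 0 < q -> 2 * n <= k ^ (p %/ q) ->
  (forall N, N <= 2 * n -> exists (W : finType) (F : algorithm W 'I_N.+1 nat),
     finds_min M N q F /\ #|W| <= N.+2 ^ w) ->
  exists2 S, S <= 4 * n * ((3 + w * k) * alpha) &
    solvable_in_words M P p n alpha S.
Proof.
case=> V [item_of [V_le /choice [ans ansP] parP]] k_gt0 q_gt0 kn.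
move=> /(_ _ V_le) [W [F [Fmin W_le]]].
have paramP X s : parameter X <= alpha -> is_stream M (@admissible P n) X s ->
    independence_number (arc_graph item_of X) <= minn alpha #|V|.
  move=> X_alpha /stream_admissible /parP /leq_trans le.
  by rewrite leq_min le // independence_number_max.
have [min0|a_gt0] := posnP (minn alpha #|V|).
  exists 0 => //; apply: (@solvable_by_constant _ _ _ _ _ (ans eq_op)).
  move=> X s prX X_alpha strm; apply: ansP => //.
    exact: stream_admissible strm.
  apply/funeq2P => u; have := paramP X s X_alpha strm.
  by rewrite min0 leqNgt independence_number_gt0.
have a_le : minn alpha #|V| <= #|V| by exact: geq_minr.
set a := minn alpha #|V| in paramP a_gt0 a_le *.
have a_alpha : a <= alpha by exact: geq_minl.
exists (2 * (#|V| * (2 + a + w * k * a))).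
  apply: (@leq_trans (2 * (2 * n * ((3 + w * k) * alpha)))); last by lia.
  rewrite leq_mul2l; apply: leq_mul => //.
  by apply: leq_trans (leq_mul (leqnn _) a_alpha); rewrite mulnDl; lia.
pose A := @closure_algorithm _ V item_of k a q k_gt0 a_gt0 W F p.
apply: (solvable_in_words_of_states (A := A) (ans := ans)).
  apply: leq_trans (card_closure_state k a_le W_le) _.
  by rewrite (expnM n.+1); apply: leq_wexp2r; nia.
move=> X s prX X_alpha strm; apply: ansP => //.
  exact: stream_admissible strm.
apply/esym/(closure_algorithmP _ _ q_gt0 Fmin _ strm).
  exact: leq_trans V_le kn.
exact: paramP strm.
Qed.

Section RealBounds.
Import Order.TTheory GRing.Theory Num.Theory.
Local Open Scope ring_scope.
Variable R : realType.

Lemma ceil_root (n q : nat) : (0 < q)%N ->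
  exists k, [/\ (0 < k)%N, (2 * n < k ^ q)%N &
    (0 < n)%N -> k%:R <= 5 * n%:R `^ (1 / q%:R) :> R].
Proof.
move=> q_gt0; have [->|n_gt0] := posnP n.
  by exists 1%N; split; rewrite ?exp1n.
have q_neq0 : q%:R != 0 :> R by rewrite pnatr_eq0 -lt0n.
have n_ge1 : 1 <= n%:R :> R by rewrite ler1n.
have invq_ge0 : 0 <= 1 / q%:R :> R by rewrite divr_ge0.
have invq_le1 : 1 / q%:R <= 1 :> R by rewrite ler_pdivrMr ?ltr0n // mul1r ler1n.
set y : R := (2 * n).+1%:R `^ (1 / q%:R); exists (Num.trunc y).+1; split=> //.
  rewrite -(ltr_nat R) natrX; apply: (@le_lt_trans _ _ (y ^+ q)).
    rewrite -powR_mulrn ?powR_ge0 // -powRrM mul1r mulVf // powRr1 // ler_nat.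
    by lia.
  by rewrite ltrXn2r ?powR_ge0 ?truncnS_gt // -lt0n.
move=> _; have root_ge1 : 1 <= n%:R `^ (1 / q%:R) :> R.
  by rewrite -{1}(powRr0 n%:R); exact: ler_powR.
have y_le : y <= 4 * n%:R `^ (1 / q%:R).
  apply: (@le_trans _ _ ((4 * n%:R) `^ (1 / q%:R))).
    apply: ge0_ler_powR => //; rewrite ?nnegrE ?mulr_ge0 //.
    by rewrite -natrM ler_nat; lia.
  rewrite powRM // ler_wpM2r ?powR_ge0 // -{2}(powRr1 (_ : 0 <= 4)) //.
  by apply: ler_powR; rewrite ?ler1n.
have : (Num.trunc y)%:R <= y by rewrite truncn_le powR_ge0.
by rewrite -natr1; lra.
Qed.

Lemma floor_sqrt (p : nat) : (0 < p)%N ->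
  exists q, [/\ (0 < q)%N, (q <= p %/ q)%N & Num.sqrt p%:R <= 2 * q%:R :> R].
Proof.
move=> p_gt0.
have ex_sqr : exists q, (q * q <= p)%N by exists 1%N.
have sqr_le q : (q * q <= p)%N -> (q <= p)%N by nia.
case: (ex_maxnP ex_sqr sqr_le) => q q_sqr q_max.
have q_gt0 : (0 < q)%N by exact: (q_max 1%N).
have p_lt : (p < q.+1 * q.+1)%N.
  by rewrite ltnNge; apply/negP => /q_max; rewrite ltnn.
exists q; split=> //; first by rewrite leq_divRL.
rewrite -(@ger0_norm _ (2 * q%:R)) ?mulr_ge0 // -sqrtr_sqr.
by apply: ler_wsqrtr; rewrite -natrM -natrX ler_nat; nia.
Qed.

Lemma words_le_powR (c alpha n k e q S : nat) (d : R) :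
  e%:R / q%:R <= d -> ((0 < n)%N -> k%:R <= 5 * n%:R `^ (1 / q%:R) :> R) ->
  (S <= c * n * (alpha * k ^ e))%N ->
  S%:R <= (c * 5 ^ e)%:R * alpha%:R * n%:R `^ (1 + d).
Proof.
move=> e_le k_le S_le; have [n0|n_gt0] := posnP n.
  move: S_le; rewrite n0 muln0 mul0n leqn0 => /eqP ->.
  by rewrite !mulr_ge0 ?powR_ge0.
have n_neq0 : n%:R != 0 :> R by rewrite pnatr_eq0 -lt0n.
rewrite powRD ?n_neq0 ?implybT // powRr1 //.
apply: (@le_trans _ _ ((c * n * (alpha * k ^ e))%:R)); first by rewrite ler_nat.
have -> : (c * 5 ^ e)%:R * alpha%:R * (n%:R * n%:R `^ d) =
    (c * n * alpha)%:R * (5%:R ^+ e * n%:R `^ d) :> R.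
  by rewrite !natrM natrX; ring.
rewrite mulnA natrM natrX ler_wpM2l //.
apply: (@le_trans _ _ ((5 * n%:R `^ (1 / q%:R)) ^+ e)).
  by apply: lerXn2r; rewrite ?nnegrE ?mulr_ge0 ?powR_ge0 ?k_le.
rewrite exprMn ler_wpM2l ?exprn_ge0 // -powR_mulrn ?powR_ge0 // -powRrM.
by apply: ler_powR; rewrite ?ler1n // mulrAC mul1r.
Qed.

Lemma solvable_insertion_only (P : problem) :
  (forall n, closure_determined P n) ->
  exists C : R, forall p n alpha : nat, (0 < p)%N ->
    solvable_in_space InsertionOnly P p n alpha
      (C * alpha%:R * n%:R `^ (1 + 1 / p%:R)).
Proof.
move=> detP; exists (16 * 5 ^ 1)%:R => p n alpha p_gt0.
have [k [k_gt0 nk k_le]] := ceil_root n p_gt0.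
have [||N _|S S_le solS] := @closure_determined_solvable InsertionOnly P
  p n alpha k 1 1 (detP n) k_gt0.
- by [].
- by rewrite divn1 ltnW.
- exists 'I_N.+2, (insertion_finder N.+1).
  by split; [exact: insertion_finderP | rewrite card_ord].
exists S; split; last exact: solS.
apply: (words_le_powR (k := k) _ k_le) => //.
apply: leq_trans S_le _; rewrite expn1; nia.
Qed.

Lemma solvable_turnstile (P : problem) :
  (forall n, closure_determined P n) ->
  exists C c : R, forall p n alpha : nat, (0 < p)%N ->
    solvable_in_space Turnstile P p n alpha
      (C * alpha%:R * n%:R `^ (1 + c / Num.sqrt p%:R)).
Proof.
move=> detP; exists (20 * 5 ^ 2)%:R, 4 => p n alpha p_gt0.
have [q [q_gt0 qp sqrt_le]] := floor_sqrt p_gt0.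
have [k [k_gt0 nk k_le]] := ceil_root n q_gt0.
have [||N N_le|S S_le solS] := @closure_determined_solvable Turnstile P
  p n alpha k q k.+1 (detP n) k_gt0.
- by [].
- by apply: leq_trans (ltnW nk) _; exact: leq_pexp2l.
- exists (search_state k.-1 N N), (search_finder k.-1 N N q); split.
    by apply: search_finderP => //; rewrite prednK //; exact: leq_ltn_trans nk.
  rewrite card_prod card_option card_ffun !card_ord prednK // expnS.
  by rewrite leq_mul2l /=; exact: leq_wexp2r.
exists S; split; last exact: solS.
apply: (words_le_powR (k := k) (q := q) (e := 2) _ k_le); last first.
  by apply: leq_trans S_le _; nia.
have sqrt_gt0 : 0 < Num.sqrt p%:R :> R by rewrite sqrtr_gt0 ltr0n.
rewrite ler_pdivlMr // mulrAC ler_pdivrMr ?ltr0n //; lra.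
Qed.

End RealBounds.

(** * The four problems *)

Lemma arc_graph_id (n : nat) (X : digraph 'I_n) :
  (forall e, e \in X -> e.1 != e.2) -> arc_graph id X = X.
Proof.
move=> irr; apply/setP => e; rewrite inE andbC.
by case: (boolP (e \in X)) => // /irr ->.
Qed.

Lemma digraph_closure_determined (ans : nat -> Type)
    (prom : forall n, digraph 'I_n -> Prop)
    (corr : forall n, digraph 'I_n -> ans n -> Prop) (n : nat) :
  (forall T : rel 'I_n, exists a, forall X : digraph 'I_n,
     prom n X -> connect (arc X) = T -> corr n X a) ->
  closure_determined (digraph_problem prom corr) n.
Proof.
move=> sol; exists 'I_n, id; split; first by rewrite card_ord leq_pmull.
  move=> T; have [a aP] := sol T; exists a => X irr prX.
  by rewrite arc_graph_id //; exact: aP.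
by move=> X irr; rewrite arc_graph_id.
Qed.

Lemma acyclic_arc (V : finType) (G : digraph V) (u v : V) :
  acyclic G -> arc G u v -> ~~ connect (arc G) v u.
Proof.
move=> acG uv; apply/negP => /connectP [p0 /shortenP [p vp up _] e].
suff: v :: p = [::] by [].
by apply: acG; rewrite /ucycle /= rcons_path vp -e uv.
Qed.

Lemma topological_order_sort_rank (n : nat) (G : digraph 'I_n) :
  acyclic G ->
  topological_order G
    (sort (relpre (rank (connect (arc G))) leq) (enum 'I_n)).
Proof.
move=> acG; set le := relpre _ _; split=> [|u v uv]; first by rewrite perm_sort.
rewrite ltnNge; apply/negP => index_vu.
have le_trans : transitive le by move=> y x z; exact: leq_trans.
have le_sorted : sorted le (sort le (enum 'I_n)).
  by apply: sort_sorted => x y; exact: leq_total.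
have : le v u.
  apply: (sorted_leq_index le_trans _ le_sorted) index_vu; last 2 first.
  - by rewrite mem_sort mem_enum.
  - by rewrite mem_sort mem_enum.
  by move=> x; exact: leqnn.
have T_trans : transitive (connect (arc G)).
  by move=> y x z; exact: connect_trans.
move/(leq_rank_rel (@connect0 _ _) T_trans).
rewrite (connect1 uv) orbT => /(_ isT).
by apply/negP; exact: acyclic_arc.
Qed.

Lemma topological_ordering_determined (n : nat) :
  closure_determined topological_ordering_problem n.
Proof.
apply: digraph_closure_determined => T.
exists (sort (relpre (rank T) leq) (enum 'I_n)) => X acX <-.
exact: topological_order_sort_rank.
Qed.

Lemma scc_determined (n : nat) : closure_determined scc_problem n.
Proof.
apply: digraph_closure_determined => T.
by exists [set [set v | T u v && T v u] | u : 'I_n] => X _ <-.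
Qed.

Lemma minimum_chain_cover_exists (V : finType) (G : digraph V) :
  exists cs, minimum_chain_cover G cs.
Proof.
have ex : exists m, `[< exists2 cs, chain_cover G cs & size cs = m >].
  exists (size [seq [:: v] | v <- enum V]); apply/asboolP.
  exists [seq [:: v] | v <- enum V] => //; apply/and3P; split.
  - by apply/allP => _ /mapP [v _ ->].
  - by apply/mapP => -[v].
  by rewrite flatten_seq1.
case: (ex_minnP ex) => _ /asboolP [cs csG <-] csmin.
exists cs; split=> // ds dsG.
by apply: csmin; apply/asboolP; exists ds.
Qed.

Lemma eq_minimum_chain_cover (V : finType) (G H : digraph V)
    (cs : seq (seq V)) :
  connect (arc G) = connect (arc H) ->
  minimum_chain_cover G cs -> minimum_chain_cover H cs.
Proof.
move=> GH; rewrite /minimum_chain_cover /chain_cover /chain.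
by rewrite /transitive_closure GH.
Qed.

Lemma minimum_chain_cover_determined (n : nat) :
  closure_determined minimum_chain_cover_problem n.
Proof.
apply: digraph_closure_determined => T.
have [[G <-]|none] := pselect (exists G : digraph 'I_n, connect (arc G) = T);
    last by exists [::] => X _ XT; case: none; exists X.
have [cs csG] := minimum_chain_cover_exists G; exists cs => X _ XG.
exact: eq_minimum_chain_cover csG.
Qed.

Definition holds (n : nat) (a : {ffun 'I_n -> bool}) (l : literal n) : bool :=
  a l.1 == l.2.

Lemma holds_neg (n : nat) (a : {ffun 'I_n -> bool}) (l : literal n) :
  holds a (neg l) = ~~ holds a l.
Proof. by rewrite /holds /=; case: (a l.1); case: l.2. Qed.

Lemma negK (n : nat) : involutive (@neg n).
Proof. by case=> x b; rewrite /neg /= negbK. Qed.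

Lemma satisfies_closed (n : nat) (a : {ffun 'I_n -> bool})
    (F : {set {set literal n}}) :
  (forall c, c \in F -> is_clause c) ->
  satisfies a F <-> (forall u v, connect (arc (implication_graph F)) u v ->
                       holds a u -> holds a v).
Proof.
move=> clF; split=> [/forall_inP sat u v /connectP [p]|closed].
  elim: p u => [|w p IH] u /=; first by move=> _ ->.
  case/andP=> uw wp e au; apply: (IH w) => //.
  move: uw; rewrite /arc /= inE /= => /andP [_ /sat /exists_inP [l]].
  rewrite !inE => /orP [] /eqP ->; last by [].
  by rewrite -/(holds a (neg u)) holds_neg au.
apply/forall_inP => c cF; have /existsP [l /existsP [l' /eqP cE]] := clF c cF.
have [al|nal] := boolP (holds a l).
  by apply/exists_inP; exists l => //; rewrite cE !inE eqxx.
apply/exists_inP; exists l'; first by rewrite cE !inE eqxx orbT.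
have [<-|ne] := eqVneq (neg l) l'; first by rewrite -/(holds _ _) holds_neg.
apply: (closed (neg l)); last by rewrite holds_neg.
by apply: connect1; rewrite /arc /= inE /= ne negK -cE.
Qed.

Lemma two_sat_determined (n : nat) : closure_determined two_sat_problem n.
Proof.
exists (literal n), (fun e => [set neg e.1; e.2]); split=> //.
  by rewrite card_prod card_ord card_bool mulnC.
move=> T.
have [[a aP]|none] := pselect (exists a : {ffun 'I_n -> bool},
    forall u v, T u v -> holds a u -> holds a v).
  by exists (Some a) => F clF _ FT; apply/(satisfies_closed _ clF); rewrite FT.
exists None => F clF _ FT a; apply/negP => /(satisfies_closed _ clF) closed.
by apply: none; exists a; rewrite -FT.
Qed.

Local Open Scope ring_scope.

Theorem theorem6p21 (R : realType) (P : problem)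
    (hP : [\/ P = topological_ordering_problem, P = scc_problem,
              P = minimum_chain_cover_problem | P = two_sat_problem]) :
  (exists C : R, forall p n alpha : nat, (0 < p)%N ->
     solvable_in_space InsertionOnly P p n alpha
       (C * alpha%:R * n%:R `^ (1 + 1 / p%:R))) /\
  (exists C c : R, forall p n alpha : nat, (0 < p)%N ->
     solvable_in_space Turnstile P p n alpha
       (C * alpha%:R * n%:R `^ (1 + c / Num.sqrt p%:R))).
Proof.
have detP n : closure_determined P n.
  case: hP => ->.
  - exact: topological_ordering_determined.
  - exact: scc_determined.
  - exact: minimum_chain_cover_determined.
  - exact: two_sat_determined.
by split; [exact: solvable_insertion_only | exact: solvable_turnstile].
Qed.
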